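(* Let $\mathcal M\models T$ be dense complete, let $A\subseteq M^{m+n}$ be a bounded fiberwise $\lambda$-Lipschitz $\mathcal C^p$ cell with $\lambda\in M^{>0}$, let $A'=\Pi_m(A)$, and let $B\subseteq M^n$. Let $(a_i)_{i<\kappa}$ be a $\kappa$-sequence in $A'$ such that $(A_{a_i})_{i<\kappa}$ converges to $B$ in the Hausdorff sense. Then there are an elementary extension $\mathcal N\succeq\mathcal M$ and $a^*\in(A')^{\mathcal N}$ such that $$\operatorname{st}_M(A_{a^*}^{\mathcal N})=\operatorname{cl}(B).$$ Equivalently, $D(\operatorname{st}_M(A_{a^*}^{\mathcal N}),B)=0$.
   Context: $T$ is a complete o-minimal expansion of the theory of real closed fields in a language $\mathcal L$; ''definable'' means definable with parameters from $M$. $\mathcal M$ is dense complete if it has no proper elementary extension $\mathcal M'\models T$ in which $M$ is dense. $M^k$ carries the sup metric $d$ and its topology; $\operatorname{cl}$ is closure. Cells: $p>0$ is an integer, $n\ge 1$. $\mathcal C^p$ cells are the usual o-minimal ones, built recursively as graphs or open bands of definable $\mathcal C^p$ functions on cells of one dimension less. $\Pi_k$ is projection onto the first $k$ coordinates; $A_a=\{x\in M^n:(a,x)\in A\}$. ''Fiberwise $\lambda$-Lipschitz'' means: $A$ is presented over the parameter coordinates (for each $k<n$, $\Pi_{m+k+1}(A)$ is a graph or a band over $\Pi_{m+k}(A)$), so all fibers $A_a$ have the same recursive cell form, and for every $a\in A'$ every finite boundary function $h(a,-)$ (graphing function, or lower or upper band function) in the recursive presentation of $A_a$ is $\lambda$-Lipschitz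 for the sup metric. For $\mathcal N\succeq\mathcal M$, $X^{\mathcal N}$ denotes the interpretation in $\mathcal N$ of an $\mathcal L(M)$-definable set $X$, and $A^{\mathcal N}_{a^*}$ is the fiber of $A^{\mathcal N}$ over $a^*$. Standard part: for $X\subseteq N^n$, $\operatorname{st}_M(X)$ is the set of all $c\in M^n$ such that some $x\in X$ satisfies $d^{\mathcal N}(x,c)<r$ for every $r\in M^{>0}$. Let $\kappa$ be the least cardinality of a coinitial subset of $M^{>0}$. The Hausdorff distance $D(X,Y)=\max\{\sup_{x\in X}\inf_{y\in Y}d(x,y),\ \sup_{y\in Y}\inf_{x\in X}d(x,y)\}$ takes values in the order completion of $M^{\ge0}$ by cuts (identifying, for each $g\in M$, the two cuts adjacent to $g$ with $g$; $\inf\varnothing=\infty$). $(X_i)_{i<\kappa}$ converges to $X$ in the Hausdorff sense if for every $\varepsilon\in M^{>0}$ there is $\gamma<\kappa$ with $D(X_i,X)<\varepsilon$ for all $\gamma<i<\kappa$. *)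

(* Defs.v *)
From HB Require Import structures.
From mathcomp Require Import all_boot all_order all_algebra.
From mathcomp Require Import all_classical.
From mathcomp Require Import interval_inference topology normedtype derive.
From mathcomp Require wochoice.

Set Implicit Arguments.
Unset Strict Implicit.
Unset Printing Implicit Defensive.

Import Order.TTheory GRing.Theory Num.Theory.
Import numFieldNormedType.Exports.

Local Open Scope classical_set_scope.
Local Open Scope card_scope.
Local Open Scope ring_scope.

(* The symbols of a language besides those of ordered rings, which are built
   into terms and formulas: [language] is a language expanding (0, 1, -, +, *, <). *)
Record language := Language {
  fsym : Type; farity : fsym -> nat;
  rsym : Type; rarity : rsym -> nat }.

Inductive term (L : language) (n : nat) : Type :=
| tvar of 'I_n
| tzero
| tone
| topp of term L n
| tadd of term L n & term L n
| tmul of term L n & term L n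
| tapp (f : fsym L) of ('I_(farity f) -> term L n).

(* [formula L n] has its free variables among 'I_n; [fex] binds variable 0. *)
Inductive formula (L : language) : nat -> Type :=
| feq n of term L n & term L n : formula L n
| flt n of term L n & term L n : formula L n
| frel n (r : rsym L) of ('I_(rarity r) -> term L n) : formula L n
| fneg n of formula L n : formula L n
| fand n of formula L n & formula L n : formula L n
| fex n of formula L n.+1 : formula L n.

Definition sentence (L : language) := formula L 0.
Definition theory (L : language) := set (sentence L).

(* The reducts to the language of ordered rings are real closed fields, so the
   models of [T] below are those of [T] together with the axioms of RCF. *)
Record structure (L : language) := Structure {
  carrier :> rcfType;
  finterp : forall f : fsym L, 'rV[carrier]_(farity f) -> carrier;
  rinterp : forall r : rsym L, set 'rV[carrier]_(rarity r) }.

Fixpoint eval (L : language) (M : structure L) (n : nat) (e : 'rV[M]_n)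
    (t : term L n) : M :=
  match t with
  | tvar i => e 0 i
  | tzero => 0
  | tone => 1
  | topp u => - eval e u
  | tadd u v => eval e u + eval e v
  | tmul u v => eval e u * eval e v
  | tapp f ts => finterp (\row_i eval e (ts i))
  end.

Fixpoint sat (L : language) (M : structure L) (n : nat) (phi : formula L n) :
    'rV[M]_n -> Prop :=
  match phi in formula _ n return 'rV[M]_n -> Prop with
  | feq _ t u => fun e => eval e t = eval e u
  | flt _ t u => fun e => eval e t < eval e u
  | frel _ r ts => fun e => rinterp (\row_i eval e (ts i))
  | fneg _ psi => fun e => ~ sat psi e
  | fand _ psi chi => fun e => sat psi e /\ sat chi e
  | fex _ psi => fun e => exists x : M, sat psi (row_mx x%:M e)
  end.

Definition models (L : language) (M : structure L) (T : theory L) :=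
  forall phi, T phi -> sat phi (0 : 'rV[M]_0).

Definition entails (L : language) (T : theory L) (phi : sentence L) :=
  forall M : structure L, models M T -> sat phi (0 : 'rV[M]_0).

Definition complete_theory (L : language) (T : theory L) :=
  (exists M : structure L, models M T) /\
  forall phi, entails T phi \/ entails T (fneg phi).

Definition definable (L : language) (M : structure L) (n : nat)
    (X : set 'rV[M]_n) :=
  exists l (phi : formula L (n + l)) (b : 'rV[M]_l),
    X = [set x | sat phi (row_mx x b)].

Definition o_minimal (L : language) (M : structure L) :=
  forall X : set 'rV[M]_1, definable X ->
  exists s : seq (interval M),
    forall x : M, X (const_mx x) <-> has (fun i : interval M => x \in i) s.

Definition o_minimal_theory (L : language) (T : theory L) :=
  forall M : structure L, models M T -> o_minimal M.

(* Elementary extensions are given by their elementary embedding. *)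
Definition elementary (L : language) (M N : structure L) (iota : M -> N) :=
  forall n (phi : formula L n) (e : 'rV[M]_n),
    sat phi e <-> sat phi (map_mx iota e).

Definition dense_complete (L : language) (T : theory L) (M : structure L) :=
  forall (M' : structure L) (iota : M -> M'),
    models M' T -> elementary iota -> dense (range iota) ->
    range iota = setT.

(* The interpretation in N of a set X definable in M; by elementarity it does
   not depend on the formula defining X (and it is empty if X is not definable). *)
Definition interp (L : language) (M N : structure L) (iota : M -> N) (n : nat)
    (X : set 'rV[M]_n) : set 'rV[N]_n :=
  [set y | exists l (phi : formula L (n + l)) (b : 'rV[M]_l),
     X = [set x | sat phi (row_mx x b)] /\ sat phi (row_mx y (map_mx iota b))].

Definition standard_part (L : language) (M N : structure L) (iota : M -> N)
    (n : nat) (X : set 'rV[N]_n) : set 'rV[M]_n :=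
  [set c | exists2 x, X x &
     forall r : M, 0 < r -> `|x - map_mx iota c| < iota r].

(* Projection onto the first k coordinates, meaningful for k <= l. *)
Definition prefix_proj (R : Type) (k l : nat) (A : set 'rV[R]_l) : set 'rV[R]_k :=
  [set y | exists2 x, A x &
     forall (i : 'I_k) (j : 'I_l), i = j :> nat -> y 0 i = x 0 j].

Arguments prefix_proj {R} k {l} A.

Definition fiber (R : Type) (m n : nat) (A : set 'rV[R]_(m + n))
    (a : 'rV[R]_m) : set 'rV[R]_n := [set x | A (row_mx a x)].

(* [col' ord_max z] consists of the first k coordinates of z : 'rV_k.+1. *)
Definition graph_over (R : Type) (k : nat) (C : set 'rV[R]_k)
    (f : 'rV[R]_k -> R) : set 'rV[R]_k.+1 :=
  [set z | C (col' ord_max z) /\ z 0 ord_max = f (col' ord_max z)].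

(* [None] stands for the constant -oo as a lower bound and +oo as an upper one. *)
Definition band_over (R : rcfType) (k : nat) (C : set 'rV[R]_k)
    (f g : option ('rV[R]_k -> R)) : set 'rV[R]_k.+1 :=
  [set z | [/\ C (col' ord_max z),
     if f is Some f' then f' (col' ord_max z) < z 0 ord_max else True &
     if g is Some g' then z 0 ord_max < g' (col' ord_max z) else True]].

(* X is a graph or a band over C, whose finite boundary functions satisfy P. *)
Definition presented_over (R : rcfType) (k : nat)
    (P : ('rV[R]_k -> R) -> Prop) (C : set 'rV[R]_k) (X : set 'rV[R]_k.+1) :=
  (exists2 f, P f & X = graph_over C f) \/
  (exists f g : option ('rV[R]_k -> R),
     [/\ if f is Some f' then P f' else True,
         if g is Some g' then P g' else True,
         if f is Some f' then
           if g is Some g' then forall x, C x -> f' x < g' x else True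
         else True &
         X = band_over C f g]).

Fixpoint Cp_on_open (R : rcfType) (k p : nat) (U : set 'rV[R]_k)
    (F : 'rV[R]_k -> R) : Prop :=
  match p with
  | 0 => forall x, U x -> {for x, continuous F}
  | q.+1 => (forall x, U x -> {for x, continuous F}) /\
      forall j : 'I_k, (forall x, U x -> derivable F x (delta_mx 0 j)) /\
        Cp_on_open q U ('D_(delta_mx 0 j) F)
  end.

(* On a cell that need not be open, a definable C^p function is the restriction
   of a definable C^p function on a definable open neighbourhood. *)
Definition Cp_definable (L : language) (M : structure L) (k p : nat)
    (C : set 'rV[M]_k) (f : 'rV[M]_k -> M) :=
  exists (U : set 'rV[M]_k) (F : 'rV[M]_k -> M),
    [/\ open U, C `<=` U, definable (graph_over U F), Cp_on_open p U F &
        forall x, C x -> F x = f x].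

Fixpoint Cp_cell (L : language) (M : structure L) (p n : nat) :
    set (set 'rV[M]_n) :=
  match n with
  | 0 => fun A => A = setT
  | k.+1 => fun A =>
      exists2 C : set 'rV[M]_k, Cp_cell p C & presented_over (Cp_definable p C) C A
  end.

(* The boundary function h of Pi_(m+k+1)(A) over Pi_(m+k)(A) restricts, for each
   a in Pi_m(A), to the boundary function h(a,-) on Pi_k(A_a). *)
Definition fiberwise_lipschitz_cell (L : language) (M : structure L)
    (p m n : nat) (lambda : M) (A : set 'rV[M]_(m + n)) :=
  Cp_cell p A /\
  forall k, (k < n)%N ->
    presented_over
      (fun h => Cp_definable p (prefix_proj (m + k) A) h /\
         forall a, prefix_proj m A a ->
         forall x y : 'rV[M]_k,
           fiber (prefix_proj (m + k) A) a x -> fiber (prefix_proj (m + k) A) a y ->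
           `|h (row_mx a x) - h (row_mx a y)| <= lambda * `|x - y|)
      (prefix_proj (m + k) A) (prefix_proj (m + k).+1 A).

Definition coinitial (R : rcfType) (S : set R) :=
  S `<=` [set r | 0 < r] /\ forall r, 0 < r -> exists2 s, S s & s <= r.

(* I is, up to isomorphism, the least cardinality of a coinitial subset of the
   positive part of R, a cardinal being an initial ordinal. *)
Definition is_coinitiality (R : rcfType) (d : Order.disp_t) (I : orderType d) :=
  [/\ wochoice.well_order (<=%O : rel I),
      forall i : I, ~~ ([set: I] #<= [set j | (j < i)%O]),
      exists S : set R, coinitial S /\ [set: I] #= S &
      forall S : set R, coinitial S -> [set: I] #<= S].

(* The order completion of the nonnegative part of R: a cut is identified with
   the set of nonnegative lower bounds of its upper part, so that both cuts
   adjacent to g become [0, g], and the whole half-line is the value oo. *)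
Definition cut_closure (R : rcfType) (S : set R) : set R :=
  [set x | 0 <= x] `&` lbound ([set u | 0 <= u] `&` ubound S).

Record cut (R : rcfType) := Cut {
  cut_set :> set R;
  cut_setP : cut_closure cut_set = cut_set }.

Lemma cut_closureK (R : rcfType) (S : set R) :
  cut_closure (cut_closure S) = cut_closure S.
Proof.
apply/seteqP; split=> x [x0 xlb]; split=> // u [u0 uub].
- by apply: xlb; split=> // y [_]; apply.
- exact: uub.
Qed.

Definition cut_of_set (R : rcfType) (S : set R) : cut R :=
  Cut (cut_closureK S).

Definition cut_of (R : rcfType) (g : R) : cut R := cut_of_set [set g].

Definition cut_lt (R : rcfType) (c c' : cut R) :=
  cut_set c `<` cut_set c'.

Definition cut_sup (R : rcfType) (F : set (cut R)) : cut R :=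
  cut_of_set (\bigcup_(c in F) cut_set c).

Definition cut_inf (R : rcfType) (F : set (cut R)) : cut R :=
  cut_of_set (\bigcap_(c in F) cut_set c).

Definition hausdorff_dist (R : rcfType) (n : nat) (X Y : set 'rV[R]_n) : cut R :=
  cut_sup [set
    cut_sup [set cut_inf [set cut_of `|x - y| | y in Y] | x in X];
    cut_sup [set cut_inf [set cut_of `|x - y| | x in X] | y in Y]].

Definition hausdorff_cvg (R : rcfType) (n : nat) (d : Order.disp_t)
    (I : orderType d) (X : I -> set 'rV[R]_n) (Y : set 'rV[R]_n) :=
  forall eps : R, 0 < eps -> exists gamma : I, forall i, (gamma < i)%O ->
    cut_lt (hausdorff_dist (X i) Y) (cut_of eps).

(* Main.v *)
(* Choose, for every r > 0 in M, an index i(r) with D(A_(a_i(r)), B) < r, and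
   let N be the ultrapower of M with index set M itself, along an ultrafilter
   containing all the intervals (0, s); take a* to be the class of r |-> a_i(r).
   By Los's theorem a point of the fiber of A^N over a* is the class of some
   e with e(r) in A_(a_i(r)) almost everywhere, and it is infinitely close to c
   in M^n iff |e(r) - c| < s almost everywhere, for every s > 0 in M. As e(r) is
   r-close to B, such a c is in cl(B); conversely, if c is in cl(B), a point
   e(r) of A_(a_i(r)) at distance less than 2r from c can be chosen for every r. *)
Require Import Defs.
From HB Require Import structures.
From mathcomp Require Import all_boot all_order all_algebra.
From mathcomp Require Import generic_quotient.
From mathcomp Require Import all_classical.
From mathcomp Require Import interval_inference topology normedtype derive.

Set Implicit Arguments.
Unset Strict Implicit.
Unset Printing Implicit Defensive.

Import Order.TTheory GRing.Theory Num.Theory.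
Import numFieldNormedType.Exports.

Local Open Scope classical_set_scope.
Local Open Scope ring_scope.

(** * Ultrapowers of real closed fields *)

(** Maximality of [U] enters through this dichotomy: properness excludes that a set and its
    complement both belong to [U], and maximality puts one of them in [U]. *)
Lemma near_ultra_not (I : Type) (U : set_system I) (UU : UltraFilter U)
    (P : I -> Prop) :
  (\forall i \near U, ~ P i) <-> ~ \forall i \near U, P i.
Proof.
split=> [UnP UP|UP].
  by have [i []] := filter_ex (filterI UP UnP).
by have [] := in_ultra_setVsetC [set i | P i] UU.
Qed.

Lemma near_ultra_or (I : Type) (U : set_system I) (UU : UltraFilter U)
    (P Q : I -> Prop) :
  (\forall i \near U, P i \/ Q i) ->
  (\forall i \near U, P i) \/ (\forall i \near U, Q i).
Proof.
move=> UPQ; have [UP|UP] := pselect (\forall i \near U, P i); first by left.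
right; have UnP := (near_ultra_not UU P).2 UP.
by apply: filterS2 UPQ UnP => i [].
Qed.

Section Ultrapower.
Variables (I : Type) (U : set_system I) (UU : UltraFilter U) (R : rcfType).

Definition ultra_eq : rel (I -> R) :=
  fun f g => `[< \forall i \near U, f i = g i >].

Lemma ultra_eq_equiv : equiv_class_of ultra_eq.
Proof.
split=> [f|f g|g f h].
- by apply/asboolP; apply: nearW.
- by apply/asboolP/asboolP; apply: filterS => i ->.
- by move=> /asboolP fg /asboolP gh; apply/asboolP; apply: filterS2 fg gh => i ->.
Qed.

Canonical ultra_eq_canonical := EquivRelPack ultra_eq_equiv.

Definition ultrapower := {eq_quot ultra_eq}%qT.

HB.instance Definition _ := EqQuotient.on ultrapower.
HB.instance Definition _ := Choice.on ultrapower.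

Definition ultra (f : I -> R) : ultrapower := (\pi_ultrapower f)%qT.

Lemma ultraP f g : ultra f = ultra g <-> \forall i \near U, f i = g i.
Proof.
split=> [/eqquotP/asboolP//|fg].
by apply/eqquotP/asboolP.
Qed.

Lemma ultra_repr x : ultra (repr x) = x.
Proof. exact: reprK. Qed.

Lemma repr_ultra f : \forall i \near U, repr (ultra f) i = f i.
Proof. by apply/ultraP; rewrite ultra_repr. Qed.

(** The operations act on the representatives picked by [repr]. By [repr_ultra] these agree almost
    everywhere with any other choice, which yields coordinatewise rules such as [addE]. *)
Let add (x y : ultrapower) : ultrapower := ultra (fun i => repr x i + repr y i).
Let opp (x : ultrapower) : ultrapower := ultra (fun i => - repr x i).
Let mul (x y : ultrapower) : ultrapower := ultra (fun i => repr x i * repr y i).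
Let inv (x : ultrapower) : ultrapower := ultra (fun i => (repr x i)^-1).
Let norm (x : ultrapower) : ultrapower := ultra (fun i => `|repr x i|).
Let le (x y : ultrapower) := `[< \forall i \near U, repr x i <= repr y i >].
(** This shape makes the axiom relating the strict and the large order hold by [erefl]; the
    coordinatewise description is recovered in [ltr_ultra]. *)
Let lt (x y : ultrapower) := (y != x) && le x y.

Let ultra2 (op : R -> R -> R) f g :
  ultra (fun i => op (repr (ultra f) i) (repr (ultra g) i)) =
  ultra (fun i => op (f i) (g i)).
Proof.
by apply/ultraP; apply: filterS2 (repr_ultra f) (repr_ultra g) => i -> ->.
Qed.

Let ultra1 (op : R -> R) f :
  ultra (fun i => op (repr (ultra f) i)) = ultra (fun i => op (f i)).
Proof. by apply/ultraP; apply: filterS (repr_ultra f) => i ->. Qed.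

Let addE f g : add (ultra f) (ultra g) = ultra (fun i => f i + g i).
Proof. exact: ultra2. Qed.
Let mulE f g : mul (ultra f) (ultra g) = ultra (fun i => f i * g i).
Proof. exact: ultra2. Qed.
Let oppE f : opp (ultra f) = ultra (fun i => - f i).
Proof. exact: ultra1. Qed.

Let addA : associative add.
Proof.
move=> x y z; rewrite -[x]ultra_repr -[y]ultra_repr -[z]ultra_repr !addE.
by apply/ultraP/nearW => i; rewrite addrA.
Qed.
Let addC : commutative add.
Proof. by move=> x y; apply/ultraP/nearW => i; rewrite addrC. Qed.
Let add0 : left_id (ultra (fun=> 0)) add.
Proof.
move=> x; rewrite -[x]ultra_repr addE.
by apply/ultraP/nearW => i; rewrite add0r.
Qed.
Let addN : left_inverse (ultra (fun=> 0)) opp add.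
Proof.
move=> x; rewrite -[x]ultra_repr oppE addE.
by apply/ultraP/nearW => i; rewrite addNr.
Qed.

HB.instance Definition _ := GRing.isZmodule.Build ultrapower addA addC add0 addN.

Let mulA : associative mul.
Proof.
move=> x y z; rewrite -[x]ultra_repr -[y]ultra_repr -[z]ultra_repr !mulE.
by apply/ultraP/nearW => i; rewrite mulrA.
Qed.
Let mulC : commutative mul.
Proof. by move=> x y; apply/ultraP/nearW => i; rewrite mulrC. Qed.
Let mul1 : left_id (ultra (fun=> 1)) mul.
Proof.
move=> x; rewrite -[x]ultra_repr mulE.
by apply/ultraP/nearW => i; rewrite mul1r.
Qed.
Let mulDl : left_distributive mul add.
Proof.
move=> x y z; rewrite -[x]ultra_repr -[y]ultra_repr -[z]ultra_repr.
rewrite !(addE, mulE).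
by apply/ultraP/nearW => i; rewrite mulrDl.
Qed.
Let one_neq0 : ultra (fun=> 1) != 0.
Proof.
by apply/eqP => /ultraP /filter_ex[i] /eqP; rewrite oner_eq0.
Qed.

HB.instance Definition _ :=
  GRing.Zmodule_isComNzRing.Build ultrapower mulA mulC mul1 mulDl one_neq0.

Let mulV x : x != 0 -> mul (inv x) x = 1.
Proof.
rewrite -[x]ultra_repr => /eqP xN0; rewrite /inv ultra1 mulE; apply/ultraP.
(* By the dichotomy, not being zero almost everywhere becomes being nonzero almost everywhere, so
   that coordinatewise inverses suffice. *)
have : ~ \forall i \near U, repr x i = 0 by move=> /ultraP.
by move=> /(near_ultra_not UU _).2; apply: filterS => i /eqP; apply: mulVf.
Qed.
Let inv0 : inv 0 = 0.
Proof.
rewrite /inv [0](_ : _ = ultra (fun=> 0))// ultra1.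
by apply/ultraP/nearW => i; rewrite invr0.
Qed.

HB.instance Definition _ := GRing.ComNzRing_isField.Build ultrapower mulV inv0.

Let leE f g : le (ultra f) (ultra g) <-> \forall i \near U, f i <= g i.
Proof.
split=> [/asboolP le_fg|le_fg].
  by apply: filterS3 (repr_ultra f) (repr_ultra g) le_fg => i -> ->.
by apply/asboolP; apply: filterS3 (repr_ultra f) (repr_ultra g) le_fg => i -> ->.
Qed.

Let le0_add x y : le 0 x -> le 0 y -> le 0 (x + y).
Proof.
rewrite -[x]ultra_repr -[y]ultra_repr => /leE x0 /leE y0.
by rewrite [_ + _]addE; apply/leE; apply: filterS2 x0 y0 => i; apply: addr_ge0.
Qed.
Let le0_mul x y : le 0 x -> le 0 y -> le 0 (x * y).
Proof.
rewrite -[x]ultra_repr -[y]ultra_repr => /leE x0 /leE y0.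
by rewrite [_ * _]mulE; apply/leE; apply: filterS2 x0 y0 => i; apply: mulr_ge0.
Qed.
Let le0_anti x : le 0 x -> le x 0 -> x = 0.
Proof.
rewrite -[x]ultra_repr => /leE x0 /leE x0'.
by apply/ultraP; apply: filterS2 x0 x0' => i h h'; apply/eqP; rewrite eq_le h h'.
Qed.
Let sub_ge0 x y : le 0 (y - x) = le x y.
Proof.
rewrite -[x]ultra_repr -[y]ultra_repr [- _]oppE [_ + _]addE.
by apply/idP/idP => /leE h; apply/leE; apply: filterS h => i; rewrite subr_ge0.
Qed.
Let le0_total x : le 0 x || le x 0.
Proof.
rewrite -[x]ultra_repr.
have : \forall i \near U, 0 <= repr x i \/ repr x i <= 0.
  by apply: nearW => i; apply/orP; apply: le_total.
by case/(near_ultra_or UU) => /leE ->; rewrite ?orbT.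
Qed.
Let normN x : norm (- x) = norm x.
Proof.
rewrite -[x]ultra_repr [- _]oppE /norm !ultra1.
by apply/ultraP/nearW => i; rewrite normrN.
Qed.
Let ge0_norm x : le 0 x -> norm x = x.
Proof.
rewrite -[x]ultra_repr => /leE x0; rewrite /norm !ultra1.
by apply/ultraP; apply: filterS x0 => i; apply: ger0_norm.
Qed.

HB.instance Definition _ := Num.IntegralDomain_isLeReal.Build ultrapower
  le0_add le0_mul le0_anti sub_ge0 le0_total normN ge0_norm (fun=> fun=> erefl).

Lemma ultra0 : ultra (fun=> 0) = 0. Proof. by []. Qed.
Lemma ultraD f g : ultra f + ultra g = ultra (fun i => f i + g i).
Proof. exact: addE. Qed.
Lemma ultraN f : - ultra f = ultra (fun i => - f i).
Proof. exact: oppE. Qed.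
Lemma ultraM f g : ultra f * ultra g = ultra (fun i => f i * g i).
Proof. exact: mulE. Qed.
Lemma ultra_norm f : `|ultra f| = ultra (fun i => `|f i|).
Proof. exact: ultra1. Qed.
Lemma ler_ultra f g : ultra f <= ultra g <-> \forall i \near U, f i <= g i.
Proof. exact: leE. Qed.
Lemma ltr_ultra f g : ultra f < ultra g <-> \forall i \near U, f i < g i.
Proof.
rewrite ltNge; split=> [/negP|lt_fg].
  rewrite ler_ultra => /(near_ultra_not UU _).2; apply: filterS => i /negP.
  by rewrite ltNge.
apply/negP => /ler_ultra le_gf.
have [i []] := filter_ex (filterI lt_fg le_gf).
by move=> /lt_le_trans/[apply]; rewrite ltxx.
Qed.

Lemma ultra_sum n (F : 'I_n -> I -> R) :
  \sum_j ultra (F j) = ultra (fun i => \sum_j F j i).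
Proof.
elim: n F => [|n IH] F.
  by rewrite big_ord0 -ultra0; apply/ultraP/nearW => i; rewrite big_ord0.
rewrite big_ord_recl IH ultraD; apply/ultraP/nearW => i.
by rewrite big_ord_recl.
Qed.

Lemma ultraX f n : ultra f ^+ n = ultra (fun i => f i ^+ n).
Proof.
elim: n => [|n IH]; first by rewrite expr0.
by rewrite exprS IH ultraM; apply/ultraP/nearW => i; rewrite exprS.
Qed.

(** The coordinate at [i] of a polynomial over the ultrapower. Its leading coefficient may vanish
    for some [i], so its degree can drop below that of [p]. *)
Definition ultra_poly (p : {poly ultrapower}) (i : I) : {poly R} :=
  \poly_(j < size p) repr p`_j i.

Lemma horner_ultra (p : {poly ultrapower}) f :
  p.[ultra f] = ultra (fun i => (ultra_poly p i).[f i]).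
Proof.
rewrite horner_coef (eq_bigr (fun j : 'I_(size p) =>
    ultra (fun i => repr p`_j i * f i ^+ j))); last first.
  by move=> j _; rewrite ultraX -[in LHS](ultra_repr p`_j) ultraM.
rewrite ultra_sum; apply/ultraP/nearW => i.
by rewrite horner_poly.
Qed.

(** The sign change of [p] happens in almost every coordinate, where the intermediate value theorem
    of [R] gives a root; the chosen roots form the class of a root of [p]. *)
Let ultrapower_closed : Num.real_closed_axiom ultrapower.
Proof.
move=> p a b; rewrite -[a]ultra_repr -[b]ultra_repr !horner_ultra.
move=> /ler_ultra ab /andP[/ler_ultra pa /ler_ultra pb].
have : \forall i \near U, exists x,
    repr a i <= x <= repr b i /\ root (ultra_poly p i) x.
  apply: filterS3 ab pa pb => i ab pa pb.
  have [|x ? ?] := @poly_ivt _ (ultra_poly p i) _ _ ab; last by exists x.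
  by apply/andP.
pose P i x := repr a i <= x <= repr b i /\ root (ultra_poly p i) x.
(* The default [0] matters only at the negligible set of indices without a root. *)
move=> UP; pose f i := xget 0 (P i).
have Uf : \forall i \near U, P i (f i).
  by apply: filterS UP => i; apply: xgetPex.
exists (ultra f).
  by apply/andP; split; apply/ler_ultra; apply: filterS Uf => i [/andP[]].
rewrite /root horner_ultra -ultra0; apply/eqP/ultraP.
by apply: filterS Uf => i [_ /rootP].
Qed.

HB.instance Definition _ := Num.RealField_isClosed.Build ultrapower ultrapower_closed.

End Ultrapower.

(** * Los's theorem *)

Lemma scalar_mx11 (R : pzRingType) (x : R) : (x%:M : 'M_1) 0 0 = x.
Proof. by rewrite mxE eqxx. Qed.

Lemma row_mx_ord0 (R : Type) n (x : 'rV[R]_1) (e : 'rV[R]_n) :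
  @fun_of_matrix R 1 n.+1 (row_mx x e) 0 ord0 = x 0 0.
Proof.
have -> : ord0 = lshift n (ord0 : 'I_1) by apply: val_inj.
by rewrite [LHS](@row_mxEl _ _ 1).
Qed.

Lemma row_mx_lift (R : Type) n (x : 'rV[R]_1) (e : 'rV[R]_n) (j : 'I_n) :
  @fun_of_matrix R 1 n.+1 (row_mx x e) 0 (lift ord0 j) = e 0 j.
Proof. by rewrite -rshift1 [LHS](@row_mxEr _ _ 1). Qed.

(** The dimensions [n.+1 + l] and [(n + l).+1] are convertible, so this case of associativity needs
    no cast. *)
Lemma row_mxA1 (R : Type) n l (x : 'rV[R]_1) (y : 'rV[R]_n) (z : 'rV[R]_l) :
  @row_mx R 1 n.+1 l (row_mx x y) z = row_mx x (row_mx y z).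
Proof.
apply/rowP => i; case: (@unliftP (n + l).+1 ord0 i) => [j|] ->.
  transitivity (row_mx y z 0 j); last exact/esym/(@row_mx_lift R).
  case: (split_ordP j) => k ->.
    have -> : lift ord0 (lshift l k) = lshift l (lift ord0 k) :> 'I_(n.+1 + l).
      exact: val_inj.
    by rewrite [LHS](@row_mxEl _ _ n.+1) row_mx_lift row_mxEl.
  have -> : lift ord0 (rshift n k) = rshift n.+1 k :> 'I_(n.+1 + l).
    exact: val_inj.
  by rewrite [LHS](@row_mxEr _ _ n.+1) row_mxEr.
rewrite row_mx_ord0.
have -> : ord0 = lshift l ord0 :> 'I_(n.+1 + l) by apply: val_inj.
by rewrite [LHS](@row_mxEl _ _ n.+1) row_mx_ord0.
Qed.

Section Los.
Variables (I : Type) (U : set_system I) (UU : UltraFilter U).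
Variables (L : language) (M : structure L).

Notation uM := (ultrapower UU M).

Definition ultra_row n (e : I -> 'rV[M]_n) : 'rV[uM]_n :=
  \row_j ultra UU (fun i => e i 0 j).

Lemma ultra_row_repr n (v : 'rV[uM]_n) :
  ultra_row (fun i => \row_j repr (v 0 j) i) = v.
Proof.
apply/rowP => j; rewrite mxE -[RHS]ultra_repr.
by apply/ultraP/nearW => i; rewrite mxE.
Qed.

Definition ultra_structure : structure L := @Structure L uM
  (fun f v => ultra UU (fun i => finterp (\row_j repr (v 0 j) i)))
  (fun r v => \forall i \near U, rinterp (r := r) (\row_j repr (v 0 j) i)).

(** A row has finitely many entries, so the sets where the individual representatives agree have an
    intersection in [U]. This makes the interpretation of the symbols independent of
    representatives. *)
Lemma near_row k (v : 'I_k -> I -> M) :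
  \forall i \near U, \row_j repr (ultra UU (v j)) i = \row_j v j i.
Proof.
have : \forall i \near U, forall j : 'I_k, repr (ultra UU (v j)) i = v j i.
  by apply: filter_forall => j; apply: repr_ultra.
by apply: filterS => i vE; apply/rowP => j; rewrite !mxE.
Qed.

Lemma eval_ultra n (t : term L n) (e : I -> 'rV[M]_n) :
  Defs.eval (ultra_row e : 'rV[ultra_structure]_n) t =
  ultra UU (fun i => Defs.eval (e i) t).
Proof.
elim: t => /= [j|||t ->|t -> u ->|t -> u ->|f ts IH].
- by rewrite mxE.
- by [].
- by [].
- by rewrite ultraN.
- by rewrite ultraD.
- by rewrite ultraM.
- apply/ultraP; apply: filterS (near_row (fun j i => Defs.eval (e i) (ts j))) => i <-.
  by congr finterp; apply/rowP => j; rewrite !mxE IH.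
Qed.

(** Induction on the formula: closure under intersections and supersets settles conjunction, the
    dichotomy settles negation, and for [fex] witnesses chosen in each coordinate are assembled into
    one class. *)
Lemma los n (phi : formula L n) (e : I -> 'rV[M]_n) :
  sat phi (ultra_row e : 'rV[ultra_structure]_n) <->
  \forall i \near U, sat phi (e i).
Proof.
elim: phi e => {n} /= [n t u|n t u|n r ts|n phi IH|n phi IH psi IH'|n phi IH] e.
- by rewrite !eval_ultra; apply: ultraP.
- by rewrite !eval_ultra; apply: ltr_ultra.
- have near_ts := near_row (fun j i => Defs.eval (e i) (ts j)).
  have tsE i : \row_j repr ((\row_j Defs.eval (ultra_row e : 'rV[ultra_structure]_n)
      (ts j)) 0 j) i = \row_j repr (ultra UU (fun i => Defs.eval (e i) (ts j))) i.
    by apply/rowP => j; rewrite !mxE eval_ultra.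
  split=> h; apply: filterS2 near_ts h => i.
    by rewrite tsE => ->.
  by rewrite tsE => ->.
- by rewrite near_ultra_not IH.
- rewrite IH IH'; split=> [[h h']|h]; first exact: filterS2 h h'.
  by split; apply: filterS h => i [].
- have rowE (x : I -> M) : row_mx (ultra UU x)%:M (ultra_row e) =
      ultra_row (fun i => row_mx (x i)%:M (e i)).
    apply/rowP => j; rewrite [RHS]mxE; case: (split_ordP j) => k ->.
      rewrite row_mxEl !mxE ord1 eqxx mulr1n; apply/ultraP/nearW => i.
      by rewrite row_mxEl mxE eqxx mulr1n.
    by rewrite row_mxEr mxE; apply/ultraP/nearW => i; rewrite row_mxEr.
  split=> [[x]|h].
    rewrite -[x]ultra_repr rowE IH; apply: filterS => i; by exists (repr x i).
  pose x i := xget 0 [set x | sat phi (row_mx x%:M (e i))].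
  exists (ultra UU x); rewrite rowE IH; apply: filterS h => i.
  exact: xgetPex.
Qed.

Definition diag (x : M) : ultra_structure := ultra UU (fun=> x).

Lemma map_diag n (e : 'rV[M]_n) : map_mx diag e = ultra_row (fun=> e).
Proof. by apply/rowP => j; rewrite !mxE. Qed.

(** Łoś's theorem for constant families: as [U] is proper, a statement independent of the index
    holds almost everywhere iff it holds. *)
Lemma elementary_diag : elementary diag.
Proof.
move=> n phi e; rewrite map_diag los; split=> [phi_e|/filter_ex[]//].
exact: nearW.
Qed.

Lemma ultra_row_mx m n (e : I -> 'rV[M]_m) (e' : I -> 'rV[M]_n) :
  row_mx (ultra_row e) (ultra_row e') = ultra_row (fun i => row_mx (e i) (e' i)).
Proof.
apply/rowP => j; rewrite [RHS]mxE; case: (split_ordP j) => k ->.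
  by rewrite row_mxEl mxE; apply/ultraP/nearW => i; rewrite row_mxEl.
by rewrite row_mxEr mxE; apply/ultraP/nearW => i; rewrite row_mxEr.
Qed.

Lemma ultra_rowB n (e e' : I -> 'rV[M]_n) :
  ultra_row e - ultra_row e' = ultra_row (fun i => e i - e' i).
Proof.
apply/rowP => j; rewrite !mxE ultraN ultraD.
by apply/ultraP/nearW => i; rewrite !mxE.
Qed.

(** Any formula defining [X] transfers by Łoś's theorem. Definability supplies one for the converse
    direction, since [interp] asks for a defining formula. *)
Lemma interp_ultra n (X : set 'rV[M]_n) (e : I -> 'rV[M]_n) : definable X ->
  interp diag X (ultra_row e) <-> \forall i \near U, X (e i).
Proof.
move=> [l [phi [b XE]]].
split=> [[l' [psi [c [-> ]]]]|].
  by rewrite map_diag ultra_row_mx los.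
move=> UX; exists l, phi, b; split=> //.
by rewrite map_diag ultra_row_mx los; apply: filterS UX => i; rewrite XE.
Qed.

Lemma ultra_row_norm_lt n (e : I -> 'rV[M]_n) (r : M) : 0 < r ->
  `|ultra_row e| < diag r <-> \forall i \near U, `|e i| < r.
Proof.
move=> r0.
(* The maximum defining the norm starts at [0], so a strict bound on it requires a positive
   right-hand side besides the bounds on the entries. *)
have dr0 : 0 < diag r by rewrite -ultra0; apply/ltr_ultra; apply: nearW.
rewrite [`|ultra_row e|]mx_normrE; split=> [/bigmax_ltP[_ h]|h].
  have : \forall i \near U, forall j, `|e i 0 j| < r.
    apply: filter_forall => j; move: (h (0, j) isT).
    by rewrite /= mxE ultra_norm => /ltr_ultra.
  apply: filterS => i hi; rewrite [`|_|]mx_normrE; apply/bigmax_ltP.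
  by split=> // -[j k] _ /=; rewrite ord1.
apply/bigmax_ltP; split=> // -[j k] _ /=; rewrite ord1 mxE ultra_norm.
apply/ltr_ultra; apply: filterS h => i; rewrite [`|_|]mx_normrE.
by move=> /bigmax_ltP[_ /(_ (0, k) isT)].
Qed.

End Los.

(** * Definability of cells and projections *)

Definition lift_ren n k (s : 'I_n -> 'I_k) (i : 'I_n.+1) : 'I_k.+1 :=
  if unlift ord0 i is Some j then lift ord0 (s j) else ord0.

Fixpoint trename (L : language) n k (s : 'I_n -> 'I_k) (t : term L n) : term L k :=
  match t with
  | tvar i => tvar L (s i)
  | tzero => tzero L k
  | tone => tone L k
  | topp u => topp (trename s u)
  | tadd u v => tadd (trename s u) (trename s v)
  | tmul u v => tmul (trename s u) (trename s v)
  | tapp f ts => tapp (fun i => trename s (ts i))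
  end.

Fixpoint frename (L : language) n (phi : formula L n) :
    forall k, ('I_n -> 'I_k) -> formula L k :=
  match phi in formula _ n return forall k, ('I_n -> 'I_k) -> formula L k with
  | feq _ t u => fun k s => feq (trename s t) (trename s u)
  | flt _ t u => fun k s => flt (trename s t) (trename s u)
  | Defs.frel _ r ts => fun k s => Defs.frel (fun i => trename s (ts i))
  | fneg _ psi => fun k s => fneg (frename psi s)
  | fand _ psi chi => fun k s => fand (frename psi s) (frename chi s)
  | fex _ psi => fun k s => fex (frename psi (lift_ren s))
  end.

Section Definable.
Variables (L : language) (M : structure L).

Lemma eval_trename n k (s : 'I_n -> 'I_k) (t : term L n) (e : 'rV[M]_k) :
  Defs.eval e (trename s t) = Defs.eval (\row_i e 0 (s i)) t.
Proof.
elim: t => //= [j|t ->|t -> u ->|t -> u ->|f ts IH] //.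
  by rewrite mxE.
by congr finterp; apply/rowP => j; rewrite !mxE IH.
Qed.

(** Renaming variables along [s] pulls assignments back along [s]. All rearrangements of coordinates
    and parameters below reduce to this. *)
Lemma sat_frename n (phi : formula L n) k (s : 'I_n -> 'I_k) (e : 'rV[M]_k) :
  sat (frename phi s) e <-> sat phi (\row_i e 0 (s i)).
Proof.
elim: phi k s e => {n} /= [n t u|n t u|n r ts|n phi IH|n phi IH psi IH'|n phi IH] k s e.
- by rewrite !eval_trename.
- by rewrite !eval_trename.
- have -> : \row_i Defs.eval e (trename s (ts i)) =
      \row_i Defs.eval (\row_i e 0 (s i)) (ts i).
    by apply/rowP => j; rewrite !mxE eval_trename.
  by [].
- by rewrite IH.
- by rewrite IH IH'.
- have rowE (x : M) : \row_i (row_mx x%:M e : 'rV_k.+1) 0 (lift_ren s i) =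
      row_mx x%:M (\row_i e 0 (s i)).
    apply/rowP => i; rewrite mxE /lift_ren; case: unliftP => [j|] ->.
      by rewrite !row_mx_lift mxE.
    by rewrite !row_mx_ord0 scalar_mx11.
  by split=> -[x sat_x]; exists x; move: sat_x; rewrite IH rowE.
Qed.

Lemma definable_preimage n k (X : set 'rV[M]_n) (s : 'I_n -> 'I_k) :
  definable X -> definable [set y : 'rV[M]_k | X (\row_i y 0 (s i))].
Proof.
move=> [l [phi [b ->]]].
pose s' (i : 'I_(n + l)) : 'I_(k + l) :=
  match fintype.split i with inl j => lshift l (s j) | inr j => rshift k j end.
exists l, (frename phi s'), b; apply/funext => y; apply/propext => /=.
rewrite sat_frename.
suff -> : \row_i row_mx y b 0 (s' i) = row_mx (\row_i y 0 (s i)) b by [].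
apply/rowP => i; rewrite mxE; case: (split_ordP i) => j ->; rewrite /s'.
  by rewrite (unsplitK (inl j)) !row_mxEl mxE.
by rewrite (unsplitK (inr j)) !row_mxEr.
Qed.

(** The two rows of parameters are concatenated, and each formula is renamed so as to read its own
    block. *)
Lemma definableI n (X Y : set 'rV[M]_n) :
  definable X -> definable Y -> definable (X `&` Y).
Proof.
move=> [l [phi [b ->]]] [l' [psi [b' ->]]].
pose s (i : 'I_(n + l)) : 'I_(n + (l + l')) :=
  match fintype.split i with inl j => lshift _ j | inr j => rshift n (lshift l' j) end.
pose s' (i : 'I_(n + l')) : 'I_(n + (l + l')) :=
  match fintype.split i with inl j => lshift _ j | inr j => rshift n (rshift l j) end.
exists (l + l')%N, (fand (frename phi s) (frename psi s')), (row_mx b b').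
apply/funext => y; apply/propext => /=.
rewrite !sat_frename.
have -> : \row_i row_mx y (row_mx b b') 0 (s i) = row_mx y b.
  apply/rowP => i; rewrite mxE; case: (split_ordP i) => j ->; rewrite /s.
    by rewrite (unsplitK (inl j)) !row_mxEl.
  by rewrite (unsplitK (inr j)) !row_mxEr row_mxEl.
suff -> : \row_i row_mx y (row_mx b b') 0 (s' i) = row_mx y b' by [].
apply/rowP => i; rewrite mxE; case: (split_ordP i) => j ->; rewrite /s'.
  by rewrite (unsplitK (inl j)) !row_mxEl.
by rewrite (unsplitK (inr j)) !row_mxEr.
Qed.

(** The quantified coordinate comes first because [fex] binds variable 0. *)
Lemma definable_exists n (X : set 'rV[M]_n.+1) :
  definable X -> definable [set y : 'rV[M]_n | exists t : M, X (row_mx t%:M y)].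
Proof.
move=> [l [phi [b ->]]]; exists l, (fex (phi : formula L (n + l).+1)), b.
apply/funext => y; apply/propext => /=.
by split=> -[t sat_t]; exists t; move: sat_t; rewrite row_mxA1.
Qed.

Lemma definableT n : definable [set: 'rV[M]_n].
Proof.
exists 0%N, (feq (tzero L _) (tzero L _)), 0.
by apply/funext => y; apply/propext.
Qed.

Lemma definable_ltr n (i j : 'I_n) : definable [set y : 'rV[M]_n | y 0 i < y 0 j].
Proof.
exists 0%N, (flt (tvar L (lshift 0 i)) (tvar L (lshift 0 j))), 0.
by apply/funext => y; apply/propext; rewrite /= !row_mxEl.
Qed.

Lemma definable_exists_row n k (X : set 'rV[M]_(n + k)) :
  definable X -> definable [set y : 'rV[M]_k | exists x : 'rV_n, X (row_mx x y)].
Proof.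
elim: n X => [|n IH] X defX.
  have -> : [set y : 'rV[M]_k | exists x : 'rV_0, X (row_mx x y)] = X.
    apply/funext => y; apply/propext; split=> [[x]|Xy].
      by rewrite row_thin_mx.
    by exists 0; rewrite row_thin_mx.
  exact: defX.
have := IH _ (definable_exists (defX : definable (X : set 'rV_(n + k).+1))).
congr definable; apply/funext => y; apply/propext; split=> [[x [t Xtx]]|[x Xx]].
  by exists (row_mx t%:M x : 'rV_n.+1); move: Xtx; rewrite row_mxA1.
exists (rsubmx (x : 'rV_(1 + n))), (lsubmx (x : 'rV_(1 + n)) 0 0).
by move: Xx; rewrite -mx11_scalar -row_mxA1 hsubmxK.
Qed.

Lemma definable_prefix_proj m n (X : set 'rV[M]_(m + n)) :
  definable X -> definable (prefix_proj m X).
Proof.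
(* Quantification removes leading coordinates, whereas the projection keeps them; [s] exchanges the
   two blocks. *)
pose s (i : 'I_(m + n)) : 'I_(n + m) :=
  match fintype.split i with inl j => rshift n j | inr j => lshift m j end.
move=> /(@definable_preimage _ _ _ s)/definable_exists_row.
congr definable; apply/funext => y; apply/propext.
have rowE (x : 'rV_n) : \row_i row_mx x y 0 (s i) = row_mx y x.
  apply/rowP => i; rewrite mxE; case: (split_ordP i) => j ->; rewrite /s.
    by rewrite (unsplitK (inl j)) row_mxEl row_mxEr.
  by rewrite (unsplitK (inr j)) row_mxEl row_mxEr.
split=> [[x]|[x Xx xy]] /=.
  rewrite rowE => Xyx; exists (row_mx y x) => // i j ij.
  by rewrite (_ : j = lshift n i) ?row_mxEl//; apply: val_inj.
exists (rsubmx x); rewrite rowE.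
suff -> : y = lsubmx x by rewrite hsubmxK.
by apply/rowP => i; rewrite mxE; apply: xy.
Qed.

(* The boundary functions are only accessible through their graphs [G], so the
   value [t] of the function has to be quantified. *)
Lemma definable_band_bound k (G : set 'rV[M]_k.+1) (lower : bool) :
  definable G ->
  definable [set z : 'rV[M]_k.+1 | exists2 t : M,
     G (\row_i if unlift ord_max i is Some j then z 0 (lift ord_max j) else t) &
     if lower then t < z 0 ord_max else z 0 ord_max < t].
Proof.
pose s (i : 'I_k.+1) : 'I_k.+2 :=
  if unlift ord_max i is Some j then lift ord0 (lift ord_max j) else ord0.
move=> /(@definable_preimage _ _ _ s) defG.
have defL : definable [set y : 'rV[M]_k.+2 | if lower then
    y 0 ord0 < y 0 (lift ord0 ord_max) else y 0 (lift ord0 ord_max) < y 0 ord0].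
  by case: lower; apply: definable_ltr.
have := definable_exists (definableI defG defL).
congr definable; apply/funext => z; apply/propext.
have rowE (t : M) : \row_i (row_mx t%:M z : 'rV_k.+2) 0 (s i) =
    \row_i if unlift ord_max i is Some j then z 0 (lift ord_max j) else t.
  apply/rowP => i; rewrite [LHS]mxE [RHS]mxE /s; case: unliftP => [j|] _.
    by rewrite row_mx_lift.
  by rewrite row_mx_ord0 scalar_mx11.
have ltE (t : M) :
    (if lower then (row_mx t%:M z : 'rV_k.+2) 0 ord0 <
                   (row_mx t%:M z : 'rV_k.+2) 0 (lift ord0 ord_max)
     else (row_mx t%:M z : 'rV_k.+2) 0 (lift ord0 ord_max) <
          (row_mx t%:M z : 'rV_k.+2) 0 ord0) =
    (if lower then t < z 0 ord_max else z 0 ord_max < t).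
  by rewrite row_mx_lift row_mx_ord0 scalar_mx11.
split=> [[t [/=]]|[t Gt lt_t]]; first by rewrite rowE ltE; exists t.
by exists t; split; rewrite /= ?rowE ?ltE.
Qed.

(** A boundary function [h] is only known to agree on [C] with a function [F] whose graph over some
    [U] containing [C] is definable. Intersecting with the cylinder over [C] allows [F] to replace
    [h]. *)
Lemma definable_presented_over p k (P : ('rV[M]_k -> M) -> Prop)
    (C : set 'rV[M]_k) (X : set 'rV[M]_k.+1) :
  (forall h, P h -> Cp_definable p C h) -> definable C ->
  presented_over P C X -> definable X.
Proof.
move=> Pdef defC.
have defCyl : definable [set z : 'rV[M]_k.+1 | C (col' ord_max z)].
  have := definable_preimage (fun i => lift ord_max i) defC.
  congr definable; apply/funext => z; rewrite /=; congr C.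
  by apply/rowP => i; rewrite !mxE.
have graph_row (U : set 'rV[M]_k) F (z : 'rV[M]_k.+1) t :
    graph_over U F (\row_i if unlift ord_max i is Some j
      then z 0 (lift ord_max j) else t) <-> U (col' ord_max z) /\ t = F (col' ord_max z).
  rewrite /graph_over /= mxE unlift_none.
  set w := col' _ _; have -> : w = col' ord_max z; last by [].
  by apply/rowP => i; rewrite !mxE liftK.
(* Each side of a band is treated separately, an infinite bound leaving the whole cylinder; the band
   is the intersection of both sides. *)
have defB (lower : bool) (h : option ('rV[M]_k -> M)) :
    (if h is Some h' then P h' else True) ->
    definable [set z : 'rV[M]_k.+1 | C (col' ord_max z) /\
      (if h is Some h' then
        if lower then h' (col' ord_max z) < z 0 ord_max
        else z 0 ord_max < h' (col' ord_max z) else True)].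
  case: h => [h /Pdef [U [F [_ CU defF _ hF]]]|_]; last first.
    have := defCyl; congr definable.
    by apply/funext => z; apply/propext; split=> // -[].
  have := definableI defCyl (definable_band_bound lower defF).
  congr definable; apply/funext => z; apply/propext; split=> -[Cz].
    by move=> [t /graph_row[_ ->]]; rewrite hF.
  move=> lt_z; split=> //; exists (h (col' ord_max z)) => //.
  by apply/graph_row; split; [exact: CU|rewrite hF].
move=> [[h /Pdef [U [F [_ CU defF _ hF]]] ->]|[f [g [Pf Pg _ ->]]]].
  have := definableI defCyl defF.
  congr definable; apply/funext => z; apply/propext; split=> [[Cz [_ zE]]|[Cz zE]].
    by split=> //; rewrite zE hF.
  by split=> //; split; [exact: CU|rewrite hF].
have := definableI (defB true f Pf) (defB false g Pg).
congr definable; apply/funext => z; apply/propext.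
by split=> [[[? ?] [_ ?]]|[? ? ?]].
Qed.

Lemma definable_Cp_cell p n (X : set 'rV[M]_n) : Cp_cell p X -> definable X.
Proof.
elim: n X => [|n IH] X /=; first by move=> ->; exact: definableT.
by move=> [C /IH defC]; apply: (definable_presented_over _ defC) => h; exact.
Qed.

End Definable.

(** * Coinitiality and the Hausdorff distance *)

Lemma coinitial_infinite (R : rcfType) (S : set R) :
  coinitial S -> infinite_set S.
Proof.
move=> [S_gt0 S_min] /finite_seqP[s SE].
(* Starting the minimum at [1] keeps [r] positive even if [s] is empty; no element of [S] is then
   below [r / 2]. *)
pose r := \big[Num.min/1]_(x <- s) x.
have r_gt0 : 0 < r.
  rewrite /r big_seq; apply: (big_ind (fun x => 0 < x)) => //.
    by move=> x y x0 y0; rewrite lt_min x0.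
  by move=> x xs; apply: S_gt0; rewrite SE.
have [x Sx] := S_min _ (divr_gt0 r_gt0 (ltr0n _ 2)).
rewrite leNgt => /negP; apply.
have : r <= x by apply: ge_bigmin_seq => //; rewrite SE in Sx.
by apply: lt_le_trans; rewrite ltr_pdivrMr// ltr_pMr// ltr1n.
Qed.

(** Hilbert's hotel: along an injective sequence [f] avoiding [t], the map [h] sends [t] to [f 0]
    and [f i] to [f i.+1], and fixes everything else. *)
Lemma infinite_card_setD1 (T : Type) (t : T) :
  infinite_set [set: T] -> ([set: T] #<= [set~ t])%card.
Proof.
elim/Ppointed: T => T in t *; first by case: (no t).
move=> Tinf.
have /infiniteP/pcard_leP[f] : infinite_set [set~ t].
  by rewrite -setTD; apply: infinite_setD => //; apply: finite_set1.
have f_inj i j : f i = f j -> i = j by apply: 'inj_f; rewrite inE.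
have fNt i : f i <> t by exact: (@funS _ _ _ _ f i I).
pose h x := if pselect (x = t) is left _ then f 0%N else
  if pselect (exists i, f i = x) is left ex_i then f (projT1 (cid ex_i)).+1 else x.
have ht : h t = f 0%N by rewrite /h; case: pselect.
have hf i : h (f i) = f i.+1.
  rewrite /h; case: pselect => [/fNt//|_]; case: pselect => [ex_i|[]]; last by exists i.
  by congr (f _.+1); apply: f_inj; exact: projT2 (cid ex_i).
have hN x : x <> t -> ~ (exists i, f i = x) -> h x = x.
  by move=> xt xf; rewrite /h; case: pselect => //; case: pselect.
have hP x : [\/ x = t, exists i, f i = x | x <> t /\ ~ exists i, f i = x].
  have [xt|xt] := pselect (x = t); first by constructor 1.
  by have [xf|xf] := pselect (exists i, f i = x); [constructor 2|constructor 3].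
have /injfunPex[g] : exists2 h : T -> T, set_fun setT [set~ t] h & set_inj setT h.
  exists h => [x _|x y _ _] /=.
    have [->|[i <-]|[xt xf]] := hP x; last by rewrite hN.
      by rewrite ht.
    by rewrite hf.
  have [->|[i <-]|[xt xf]] := hP x; have [->|[j <-]|[yt yf]] := hP y => //;
    rewrite ?ht ?hf ?(hN x)// ?(hN y)//.
  - by move=> /f_inj.
  - by move=> fy; case: yf; exists 0%N.
  - by move=> /f_inj.
  - by move=> /f_inj[->].
  - by move=> fy; case: yf; exists i.+1.
  - by move=> fx; case: xf; exists 0%N.
  - by move=> fx; case: xf; exists j.+1.
exact: inj_card_le g.
Qed.

(** If [i] were the largest element, its predecessors would form the complement of a point in an
    infinite set. They would be as numerous as [I], against [I] being an initial ordinal. *)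
Lemma is_coinitiality_unbounded (R : rcfType) d (I : orderType d) :
  is_coinitiality R I -> forall i : I, exists j, (i < j)%O.
Proof.
move=> [_ I_initial [S [Scoin IS]] _] i; apply: contrapT => i_max.
have Iinf : infinite_set [set: I].
  by rewrite (eq_finite_set IS); exact: coinitial_infinite.
have /negP := I_initial i; apply.
suff <- : [set~ i] = [set j | (j < i)%O] by exact: infinite_card_setD1.
apply/seteqP; split=> j /=; last by move=> + ij; rewrite ij ltxx.
move=> /eqP ji; rewrite lt_neqAle ji leNgt; apply/negP => ij.
by apply: i_max; exists j.
Qed.

(** * Cuts ordered by inclusion, and points extracted from bounds on the Hausdorff distance *)

Section Cut.
Variable R : rcfType.
Implicit Types (c : cut R) (F : set (cut R)) (S : set R) (g eps : R).

Lemma cut_eq c c' : cut_set c = cut_set c' -> c = c'.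
Proof.
case: c c' => [S SP] [S' S'P] /= SS'; move: S'P; rewrite -SS' => S'P.
by congr Cut; apply: Prop_irrelevance.
Qed.

Lemma cut_ge0 c x : cut_set c x -> 0 <= x.
Proof. by rewrite -[cut_set c]cut_setP => -[]. Qed.

Lemma cut_closure_mono S S' : S `<=` S' -> cut_closure S `<=` cut_closure S'.
Proof.
move=> SS' x [x0 xlb]; split=> // u [u0 ub]; apply: xlb.
by split=> // y /SS'; apply: ub.
Qed.

Lemma sub_cut_closure S : S `<=` [set x | 0 <= x] -> S `<=` cut_closure S.
Proof. by move=> S0 x Sx; split=> [|u [_]]; [exact: S0|exact]. Qed.

Lemma cut_ofE g : 0 <= g -> cut_set (cut_of g) = [set x | 0 <= x <= g].
Proof.
move=> g0; apply/seteqP; split=> x /=.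
  by move=> [x0 xg]; apply/andP; split=> //; apply: xg; split=> // y ->.
by move=> /andP[x0 xg]; split=> // u [_ ub]; apply: le_trans xg (ub _ _).
Qed.

Lemma cut0_sub c : cut_set (cut_of 0) `<=` cut_set c.
Proof.
rewrite cut_ofE// => x /=; rewrite -eq_le => /eqP <-.
by rewrite -[cut_set c]cut_setP; split=> [|u []] /=.
Qed.

Lemma sub_cut_sup F c : F c -> cut_set c `<=` cut_set (cut_sup F).
Proof.
move=> Fc x cx; apply: sub_cut_closure; last by exists c.
by move=> y [c' _]; apply: cut_ge0.
Qed.

Lemma cut_sup_sub F c :
  (forall c', F c' -> cut_set c' `<=` cut_set c) ->
  cut_set (cut_sup F) `<=` cut_set c.
Proof.
move=> Fc; rewrite -[cut_set c]cut_setP; apply: cut_closure_mono.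
by move=> x [c' /Fc]; apply.
Qed.

Lemma sub_cut_inf F c :
  (forall c', F c' -> cut_set c `<=` cut_set c') ->
  cut_set c `<=` cut_set (cut_inf F).
Proof.
move=> Fc; rewrite -[cut_set c]cut_setP; apply: cut_closure_mono.
by move=> x cx c' Fc'; apply: (Fc c').
Qed.

Lemma cut_inf_sub F c : F c -> cut_set (cut_inf F) `<=` cut_set c.
Proof.
move=> Fc; rewrite -[cut_set c]cut_setP; apply: cut_closure_mono.
by move=> x; apply.
Qed.

(** If every [dist y] were at least [eps], the segment from 0 to [eps] would lie in the infimum,
    hence in [c], against strict inclusion. Empty [Y] is covered. An arbitrary [dist] serves both
    halves of the Hausdorff distance. *)
Lemma cut_inf_dist_lt n (Y : set 'rV[R]_n) (dist : 'rV[R]_n -> R) eps c :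
  0 <= eps ->
  cut_set (cut_inf [set cut_of (dist y) | y in Y]) `<=` cut_set c ->
  cut_lt c (cut_of eps) -> exists2 y, Y y & dist y < eps.
Proof.
move=> eps0 sub_c [_ nsub]; apply: contrapT => far; apply: nsub.
apply: subset_trans sub_c; apply: sub_cut_inf => _ [y Yy <-].
have le_dist : eps <= dist y.
  by rewrite leNgt; apply/negP => lt_eps; apply: far; exists y.
rewrite !cut_ofE ?(le_trans eps0)// => t /= /andP[-> /le_trans]; exact.
Qed.

Lemma hausdorff_dist_ltl n (X Y : set 'rV[R]_n) eps x : 0 <= eps ->
  cut_lt (hausdorff_dist X Y) (cut_of eps) -> X x ->
  exists2 y, Y y & `|x - y| < eps.
Proof.
move=> eps0 lt_eps Xx; apply: cut_inf_dist_lt eps0 _ lt_eps => //.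
apply: subset_trans (sub_cut_sup _); last by left.
by apply: sub_cut_sup; exists x.
Qed.

Lemma hausdorff_dist_ltr n (X Y : set 'rV[R]_n) eps y : 0 <= eps ->
  cut_lt (hausdorff_dist X Y) (cut_of eps) -> Y y ->
  exists2 x, X x & `|x - y| < eps.
Proof.
move=> eps0 lt_eps Yy; apply: cut_inf_dist_lt eps0 _ lt_eps => //.
apply: subset_trans (sub_cut_sup _); last by right.
by apply: sub_cut_sup; exists y.
Qed.

Lemma cut_inf_eq0 n (Y : set 'rV[R]_n) (dist : 'rV[R]_n -> R) :
  (forall y, 0 <= dist y) ->
  (forall eps, 0 < eps -> exists2 y, Y y & dist y < eps) ->
  cut_set (cut_inf [set cut_of (dist y) | y in Y]) `<=` cut_set (cut_of 0).
Proof.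
move=> dist_ge0 near_Y t t_inf; have t0 := cut_ge0 t_inf.
rewrite cut_ofE//= t0 leNgt; apply/negP => /near_Y[y Yy].
have : cut_set (cut_of (dist y)) t by apply: cut_inf_sub t_inf; exists y.
by rewrite cut_ofE//= ltNge => /andP[_ ->].
Qed.

Lemma rV_closureP n (B : set 'rV[R]_n) (x : 'rV[R]_n) :
  closure B x <-> forall r, 0 < r -> exists2 y, B y & `|x - y| < r.
Proof.
split=> [clB r r0|near_B V /nbhs_ballP[r r0 rV]].
  by have [y [By]] := clB _ (nbhsx_ballx x r r0); rewrite -ball_normE; exists y.
have [y By xy] := near_B r r0; exists y; split=> //.
by apply: rV; rewrite -ball_normE.
Qed.

(** Points of the closure are approximated by points of [B], and each point of [B] is at distance 0
    from itself in the closure. *)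
Lemma hausdorff_dist_closure n (B : set 'rV[R]_n) :
  hausdorff_dist (closure B) B = cut_of 0.
Proof.
apply/cut_eq/seteqP; split; last exact: cut0_sub.
apply: cut_sup_sub => _ [] ->; apply: cut_sup_sub => _ [x Bx <-];
  apply: cut_inf_eq0 => // eps eps0.
  by have /rV_closureP/(_ _ eps0) := Bx.
by exists x; [exact: subset_closure|rewrite subrr normr0].
Qed.

End Cut.

Theorem lemma5p2 (L : language) (T : theory L)
  (T_complete : complete_theory T) (T_omin : o_minimal_theory T)
  (M : structure L) (M_T : models M T) (M_dc : dense_complete T M)
  (p m n : nat) (p_gt0 : (0 < p)%N) (n_gt0 : (0 < n)%N)
  (lambda : M) (lambda_gt0 : 0 < lambda)
  (A : set 'rV[M]_(m + n)) (A_bounded : bounded_set A)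
  (A_cell : fiberwise_lipschitz_cell p lambda A)
  (B : set 'rV[M]_n)
  (d : Order.disp_t) (kappa : orderType d) (kappaP : is_coinitiality M kappa)
  (a : kappa -> 'rV[M]_m) (a_A : forall i, prefix_proj m A (a i))
  (a_cvg : hausdorff_cvg (fun i => fiber A (a i)) B) :
  exists (N : structure L) (iota : M -> N) (astar : 'rV[N]_m),
    [/\ elementary iota,
        interp iota (prefix_proj m A) astar,
        standard_part iota (fiber (interp iota A) astar) = closure B &
        hausdorff_dist (standard_part iota (fiber (interp iota A) astar)) B
          = cut_of 0].
Proof.
have defA : definable A by case: A_cell => /definable_Cp_cell.
have /choice[idx idxP] : forall r : M, exists i, 0 < r ->
    cut_lt (hausdorff_dist (fiber A (a i)) B) (cut_of r).
  move=> r; have [r0|_] := ltP 0 r.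
    have [g gP] := a_cvg r r0.
    by have [i gi] := is_coinitiality_unbounded kappaP g; exists i => _; apply: gP.
  (* For [r <= 0] any index will do; convergence at [1] merely exhibits an element of [kappa]. *)
  by have [i _] := a_cvg 1 ltr01; exists i.
(* Refining the right neighbourhoods of 0 makes almost every index [r] positive and smaller than any
   given positive element of [M]. *)
have [U [UU at_rightU]] := ultraFilterLemma (at_right_proper_filter (0 : M)).
have U_lt (r : M) : 0 < r -> \forall s \near U, 0 < s /\ s < r.
  move=> r0; apply: at_rightU.
  by apply: filterI; [exact: nbhs_right_gt|exact: nbhs_right_lt].
pose st := standard_part (@diag _ _ UU L M)
  (fiber (interp (@diag _ _ UU L M) A) (ultra_row UU (fun r => a (idx r)))).
have stP c : st c <-> exists2 e : M -> 'rV[M]_n,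
    \forall r \near U, fiber A (a (idx r)) (e r) &
    forall s, 0 < s -> \forall r \near U, `|e r - c| < s.
  have near_c e s : 0 < s ->
      `|ultra_row UU e - map_mx (@diag _ _ UU L M) c| < diag UU s <->
      \forall r \near U, `|e r - c| < s.
    by move=> s0; rewrite map_diag ultra_rowB ultra_row_norm_lt.
  split=> [[x]|[e Ae ec]].
    rewrite -[x]ultra_row_repr /fiber /= ultra_row_mx interp_ultra// => Ae xc.
    by eexists; [exact: Ae|move=> s s0; apply/near_c => //; exact: xc].
  exists (ultra_row UU e); last by move=> s s0; apply/near_c => //; exact: ec.
  by rewrite /fiber /= ultra_row_mx interp_ultra.
have st_closure : st = closure B.
  apply/seteqP; split=> c; rewrite stP rV_closureP.
    (* One half of [s] bounds the distance from [c] to [e r], the other the distance [r] from [e r]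
       to [B]. *)
    move=> [e Ae ec] s s0; have s2 : 0 < s / 2 by rewrite divr_gt0.
    have [r [Aer [erc [r0 rs]]]] :=
      filter_ex (filterI Ae (filterI (ec _ s2) (U_lt _ s2))).
    have [y By ery] := hausdorff_dist_ltl (ltW r0) (idxP r r0) Aer.
    exists y => //; rewrite (splitr s) (le_lt_trans (ler_distD (e r) _ _))// ltrD//.
      by rewrite distrC.
    exact: lt_trans ery rs.
  (* One [r] leads from [c] to a point [y] of [B], the other from [y] to the fiber; [0] is the
     default for [r <= 0]. *)
  move=> Bc; have /choice[e eP] : forall r : M, exists x, 0 < r ->
      fiber A (a (idx r)) x /\ `|x - c| < r + r.
    move=> r; have [r0|_] := ltP 0 r; last by exists 0.
    have [y By cy] := Bc r r0.
    have [x Ax xy] := hausdorff_dist_ltr (ltW r0) (idxP r r0) By.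
    exists x => _; split=> //.
    by rewrite (le_lt_trans (ler_distD y _ _))// ltrD// distrC.
  exists e => [|s s0].
    by apply: filterS (U_lt 1 ltr01) => r [/eP[]].
  have s2 : 0 < s / 2 by rewrite divr_gt0.
  apply: filterS (U_lt _ s2) => r [/eP[_ erc] rs].
  by rewrite (lt_trans erc)// (splitr s) ltrD.
exists (ultra_structure UU M), (@diag _ _ UU L M), (ultra_row UU (fun r => a (idx r))).
split.
- exact: elementary_diag.
- by apply/interp_ultra; [exact: definable_prefix_proj|exact: nearW].
- exact: st_closure.
- by rewrite -/st st_closure; apply: hausdorff_dist_closure.
Qed.
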